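(* Let $v_1,\dots,v_n$ be unit vectors forming a basis of $\mathbb{R}^n$, and let $\leq$ be the partial order on $\mathbb{R}^n$ whose positive cone is generated by $v_1,\dots,v_n$. Assume $f\in C_c(\mathbb{R}^n)$ and let $$F(x)=\int_{y\leq x} f(y)\,d\mu .$$ Then, for every $x\in\mathbb{R}^n$, $$f(x)=\frac{1}{|\det(v_1,\dots,v_n)|}\,\frac{\partial}{\partial v_1}\cdots\frac{\partial}{\partial v_n}F(x),$$ where $\frac{\partial}{\partial v_j}$ is the directional derivative in the direction of $v_j$.
   Context: The partial order with positive cone generated by a basis $v_1,\dots,v_n$ is: $y\leq x$ if and only if $x-y=\sum_{i=1}^n c_iv_i$ with all $c_i\geq 0$. The integral over $y\le x$ is over the set $\{y\in\mathbb{R}^n: y\leq x\}$ (the negative cone at $x$), and $\mu$ is Lebesgue measure on $\mathbb{R}^n$. $C_c(\mathbb{R}^n)$ denotes the continuous compactly supported real functions. The derivatives $\frac{\partial}{\partial v_1}\cdots\frac{\partial}{\partial v_n}$ are iterated directional derivatives. *)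

(* Defs.v *)
From HB Require Import structures.
From mathcomp Require Import all_boot all_order all_algebra.
From mathcomp Require Import all_classical all_reals all_analysis.

Set Implicit Arguments.
Unset Strict Implicit.
Unset Printing Implicit Defensive.

Import Order.TTheory GRing.Theory Num.Theory.
Import numFieldNormedType.Exports.

Local Open Scope classical_set_scope.
Local Open Scope ring_scope.

(* R^n is 'rV[R]_n, with the product of the Borel sigma-algebras of R, i.e. the
   one generated by the coordinate maps, as the library does for n.-tuple. *)
Section measurable_rV.
Variables (R : realType) (n : nat).

Let coors : 'I_n -> 'rV[R]_n -> R := fun i x => x ord0 i.

Let rV_set0 : g_sigma_preimage coors set0.
Proof. exact: sigma_algebra0. Qed.

Let rV_setC A : g_sigma_preimage coors A -> g_sigma_preimage coors (~` A).
Proof. exact: sigma_algebraC. Qed.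

Let rV_bigcup (F : (set 'rV[R]_n)^nat) :
  (forall i, g_sigma_preimage coors (F i)) ->
  g_sigma_preimage coors (\bigcup_i (F i)).
Proof. exact: sigma_algebra_bigcup. Qed.

HB.instance Definition _ := @isMeasurable.Build default_measure_display
  'rV[R]_n (g_sigma_preimage coors) rV_set0 rV_setC rV_bigcup.

Lemma measurable_coor (i : 'I_n) :
  measurable_fun [set: 'rV[R]_n] (fun x => x ord0 i).
Proof.
move=> _ Y mY; rewrite setTI; apply: sub_sigma_algebra => /=.
rewrite -bigcup_seq/=; exists i => /=; first by rewrite mem_index_enum.
by exists Y => //; rewrite setTI.
Qed.

Lemma measurable_fun_rVP d (T : measurableType d) (f : T -> 'rV[R]_n) :
  (forall i, measurable_fun [set: T] (fun t => f t ord0 i)) ->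
  measurable_fun [set: T] f.
Proof.
move=> mf _ A mA; rewrite setTI.
have : preimage_set_system [set: T] f (g_sigma_preimage coors) (f @^-1` A).
  by exists A => //; rewrite setTI.
rewrite -g_sigma_preimage_comp; apply: smallest_sub.
  exact: sigma_algebra_measurable.
rewrite -bigcup_seq => B [i _] [C mC <-].
exact: mf.
Qed.

End measurable_rV.

(* Prepends the coordinate p.2 to p.1. *)
Definition consrV (R : realType) (n : nat) (p : 'rV[R]_n * R) : 'rV[R]_n.+1 :=
  row_mx p.2%:M p.1.

Lemma measurable_consrV (R : realType) (n : nat) :
  measurable_fun [set: 'rV[R]_n * R] (@consrV R n).
Proof.
apply: measurable_fun_rVP => i.
case: (@splitP 1 n i) => j ij.
- have -> : i = @lshift 1 n j by exact: val_inj.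
  rewrite (_ : (fun _ => _) = snd)//; apply/funext => p.
  by rewrite [LHS](@row_mxEl R 1 1 n) mxE [j]ord1.
- have -> : i = @rshift 1 n j by exact: val_inj.
  rewrite (_ : (fun _ => _) = (fun x : 'rV[R]_n => x ord0 j) \o fst).
    by apply: measurableT_comp => //; exact: measurable_coor.
  by apply/funext => p; rewrite [LHS](@row_mxEr R 1 1 n).
Qed.

(* Lebesgue measure on R^n, as the n-fold product of the one on R; R^0 is a
   point of mass 1. *)
Fixpoint lebesgue_rV (R : realType) (n : nat) : set 'rV[R]_n -> \bar R :=
  match n with
  | 0%N => \d_ (0 : 'rV[R]_0)
  | m.+1 => pushforward (@lebesgue_rV R m \x @lebesgue_measure R)%E (@consrV R m)
  end.
Arguments lebesgue_rV : clear implicits.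

Section lebesgue_rV_measure.
Variable R : realType.

Let lebesgue_rV_ex n :
  exists m : {measure set 'rV[R]_n -> \bar R}, m = lebesgue_rV R n :> (set _ -> _).
Proof.
elim: n => [|n [m mE]]; first by exists (\d_ (0 : 'rV[R]_0)).
pose mu := (m \x @lebesgue_measure R)%E.
exists (measure_function_pushforward__canonical__measure_function_Measure
  mu (@measurable_consrV R n)).
by rewrite /= /mu mE.
Qed.

Variable n : nat.

Let lebesgue_rV0 : lebesgue_rV R n set0 = 0%E.
Proof. by have [m <-] := lebesgue_rV_ex n; exact: measure0. Qed.

Let lebesgue_rV_ge0 A : (0 <= lebesgue_rV R n A)%E.
Proof. by have [m <-] := lebesgue_rV_ex n; exact: measure_ge0. Qed.

Let lebesgue_rV_sigma_additive : semi_sigma_additive (lebesgue_rV R n).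
Proof.
have [m <-] := lebesgue_rV_ex n; exact: measure_semi_sigma_additive.
Qed.

HB.instance Definition _ := isMeasure.Build _ _ _ (lebesgue_rV R n)
  lebesgue_rV0 lebesgue_rV_ge0 lebesgue_rV_sigma_additive.

End lebesgue_rV_measure.

Lemma lebesgue_rV_box (R : realType) (n : nat) (a b : 'rV[R]_n) :
  (forall i, a ord0 i <= b ord0 i) ->
  lebesgue_rV R n [set x | forall i, a ord0 i <= x ord0 i <= b ord0 i] =
  (\prod_(i < n) (b ord0 i - a ord0 i))%:E.
Proof.
elim: n a b => [|n IHn] a b ab.
  by rewrite big_ord0 /= diracE mem_set// => -[].
pose a' : 'rV[R]_n := \row_i a ord0 (lift ord0 i).
pose b' : 'rV[R]_n := \row_i b ord0 (lift ord0 i).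
pose box' := [set x : 'rV[R]_n | forall i, a' ord0 i <= x ord0 i <= b' ord0 i].
have mbox' : measurable box'.
  rewrite (_ : box' = \bigcap_(i in [set: 'I_n])
    ((fun x : 'rV[R]_n => x ord0 i) @^-1` `[a' ord0 i, b' ord0 i])).
    apply: fin_bigcap_measurable => // i _; rewrite -[X in measurable X]setTI.
    exact: (@measurable_coor R n i).
  apply/seteqP; split=> [x bx i _|x bx i]; first by rewrite /= in_itv /= bx.
  by have := bx i Logic.I; rewrite /= in_itv.
transitivity ((lebesgue_rV R n \x @lebesgue_measure R)%E
    (box' `*` `[a ord0 ord0, b ord0 ord0]%classic)).
  rewrite /= /pushforward; congr (_ _).
  have cons0 p : @consrV R n p ord0 ord0 = p.2.
    rewrite (_ : ord0 = @lshift 1 n ord0); last exact: val_inj.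
    by rewrite [LHS](@row_mxEl R 1 1 n) mxE eqxx mulr1n.
  have consS p i : @consrV R n p ord0 (lift ord0 i) = p.1 ord0 i.
    rewrite (_ : lift ord0 i = @rshift 1 n i); last exact: val_inj.
    by rewrite [LHS](@row_mxEr R 1 1 n).
  apply/seteqP; split=> [p bp|p [/= bp]].
    split=> /= [i|]; last by rewrite in_itv /= -cons0 bp.
    by rewrite !mxE -consS bp.
  rewrite in_itv /= => bp0 i; case: (unliftP ord0 i) => [j|] ->.
    by rewrite consS; have := bp j; rewrite !mxE.
  by rewrite cons0.
have /IHn IH i : a' ord0 i <= b' ord0 i by rewrite !mxE.
rewrite product_measure1E// [X in (X * _)%E]IH.
rewrite [X in (_ * X)%E](lebesgue_measure_itv `[a ord0 ord0, b ord0 ord0]).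
rewrite big_ord_recl /= lte_fin muleC.
under eq_bigr do rewrite !mxE.
case: ifPn => [_|]; first by rewrite -EFinB -EFinM.
rewrite -leNgt => ba.
by rewrite mul0e (@le_anti _ _ (a ord0 ord0) (b ord0 ord0)) ?ab ?ba// subrr mul0r.
Qed.

(* The norm `|u| of a row vector is the supremum norm. *)
Definition l2norm (R : realType) (n : nat) (u : 'rV[R]_n) : R :=
  Num.sqrt (\sum_(i < n) u ord0 i ^+ 2).

Definition cone_le (R : realType) (n : nat) (v : n.-tuple 'rV[R]_n)
    (y x : 'rV[R]_n) : Prop :=
  exists c : 'I_n -> R,
    (forall i, 0 <= c i) /\ x - y = \sum_(i < n) c i *: tnth v i.

Definition Cc (R : realType) (n : nat) : set ('rV[R]_n -> R) :=
  [set f | continuous f /\ compact (closure [set x | f x != 0])].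

Section iterated_derivative.
Variables (R : realType) (n : nat).
Implicit Types (F : 'rV[R]_n -> R) (s : seq 'rV[R]_n).

(* iter_derive [:: u_1; ...; u_k] F = 'D_u_1 (... ('D_u_k F)). *)
Definition iter_derive s F : 'rV[R]_n -> R := foldr (fun u G => 'D_u G) F s.

(* 'D_u is total, so the existence of every derivative in iter_derive s F, at
   every point, is a separate property. *)
Fixpoint iter_derivable s F : Prop :=
  if s is u :: s' then
    iter_derivable s' F /\ forall x, derivable (iter_derive s' F) x u
  else True.

End iterated_derivative.

(* Main.v *)
Require Import Defs.
From HB Require Import structures.
From mathcomp Require Import all_boot all_order all_algebra.
From mathcomp Require Import all_classical all_reals all_analysis.
From mathcomp Require Import measurable_realfun ring.

(** The cone below x is parametrised by the nonpositive orthant: y <= x holds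
    exactly when y = x + \sum_i c_i v_i with all c_i <= 0. The linear change of
    variables y = x + c V, where V has the rows v_i, therefore turns F(x) into
    |det V| times the integral of f(x + \sum_i c_i v_i) over that orthant
    ([integral_affine_rV]). By Fubini the orthant integral is an iterated
    integral: it applies to f, for u = v_1, ..., v_n in turn, the operator
    [ray_integral u], which integrates a function along the ray pointing from x
    in the direction -u ([integral_orthant]). By the fundamental theorem of
    calculus the directional derivative along u undoes [ray_integral u]
    ([derive_ray_integral]). In d/dv_1 ... d/dv_n F the outermost integral,
    along v_n, meets the innermost derivative, along v_n, so integrals and
    derivatives cancel pair by pair and leave |det V| f
    ([iter_derive_ray_integral]).

    Two points need care. A ray integral of a compactly supported function is
    no longer compactly supported, so the induction runs over a larger class:
    the continuous functions that vanish on some half-space l < M, where l is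
    the linear form taking the value 1 on every v_i ([half_supported]). On a ray
    of direction -v_i the form l decreases to -oo, so only a bounded part of the
    ray contributes, and the class is stable under [ray_integral v_i].

    The change of variables [change_of_variables_unit] is proved by induction on
    the dimension: a matrix with a nonzero pivot is the product of a lower
    shear, a block diagonal matrix and an upper shear. Tonelli reduces shears to
    translation invariance and block diagonal matrices to scaling on the line
    and to the induction hypothesis. *)

Set Implicit Arguments.
Unset Strict Implicit.
Unset Printing Implicit Defensive.

Import Order.TTheory GRing.Theory Num.Theory.
Import numFieldNormedType.Exports.

Local Open Scope classical_set_scope.
Local Open Scope ring_scope.

(** * Affine changes of variable on the line *)

Section affine_1d.
Variable R : realType.
Notation leb := (@lebesgue_measure R).

Lemma measurable_translation (b : R) :
  @measurable_fun _ _ (measurableTypeR R) (measurableTypeR R) setT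
    (fun t : R => t + b).
Proof. exact: measurable_funD. Qed.

Lemma measurable_dilation (a : R) :
  @measurable_fun _ _ (measurableTypeR R) (measurableTypeR R) setT
    (fun t : R => a * t).
Proof. exact: measurable_funM. Qed.

Lemma lebesgue_measureD (b : R) (A : set (measurableTypeR R)) :
  measurable A -> leb ((fun t => t + b) @^-1` A) = leb A.
Proof.
move=> mA; apply/esym.
pose mu := measure_function_pushforward__canonical__measure_function_Measure
  leb (measurable_translation b).
apply: (@lebesgue_measure_unique R mu _ A mA) => _ [[x y] _ <-].
rewrite /mu /= /pushforward.
have -> : (fun t : R => t + b) @^-1` `]x, y] = `](x - b), (y - b)]%classic.
  by apply/seteqP; split=> t /=; rewrite !in_itv /= ltrBlDr lerBrDr.
rewrite !lebesgue_measure_itv /= !lte_fin ltrBlDr subrK.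
by case: ifPn => // _; rewrite -!EFinB; congr EFin; ring.
Qed.

Lemma lebesgue_measureZ (a : R) (A : set (measurableTypeR R)) : a != 0 ->
  measurable A -> (`|a|%:E * leb ((fun t => (a * t)%R) @^-1` A))%E = leb A.
Proof.
move=> a0 mA; apply/esym.
pose mu := mscale (NngNum (normr_ge0 a))
  (measure_function_pushforward__canonical__measure_function_Measure
    leb (measurable_dilation a)).
change (leb A = mu A).
apply: (@lebesgue_measure_unique R mu _ A mA) => _ [[x y] _ <-].
rewrite /mu /= /mscale /= /pushforward.
have [a_lt0|a_gt0|aE] := ltgtP a 0; last by rewrite aE eqxx in a0.
- have -> : (fun t : R => a * t) @^-1` `]x, y] =
      `[(a^-1 * y), (a^-1 * x)[%classic.
    apply/seteqP; split=> t /=; rewrite !in_itv /=.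
      by rewrite ler_ndivrMl // ltr_ndivlMl // => /andP[-> ->].
    by rewrite ler_ndivrMl // ltr_ndivlMl // => /andP[-> ->].
  rewrite !lebesgue_measure_itv /= !lte_fin ltr_nM2l ?invr_lt0 //.
  rewrite ltr0_norm //; case: ifPn => _; last by rewrite mule0.
  by rewrite -!EFinB -EFinM; congr EFin; field.
- have -> : (fun t : R => a * t) @^-1` `]x, y] =
      `](a^-1 * x), (a^-1 * y)]%classic.
    apply/seteqP; split=> t /=; rewrite !in_itv /=.
      by rewrite ler_pdivlMl // ltr_pdivrMl // => /andP[-> ->].
    by rewrite ler_pdivlMl // ltr_pdivrMl // => /andP[-> ->].
  rewrite !lebesgue_measure_itv /= !lte_fin ltr_pM2l ?invr_gt0 //.
  rewrite gtr0_norm //; case: ifPn => _; last by rewrite mule0.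
  by rewrite -!EFinB -EFinM; congr EFin; field.
Qed.

Lemma ge0_integral_lebesgueD (b : R) (g : R -> \bar R) :
  measurable_fun [set: measurableTypeR R] g -> (forall t, (0 <= g t)%E) ->
  (\int[leb]_t g (t + b)%R = \int[leb]_t g t)%E.
Proof.
move=> mg g0.
have /esym := @ge0_integral_pushforward _ _ _ _ R _
  (measurable_translation b) leb setT g measurableT mg (fun t _ => g0 t).
rewrite preimage_setT => ->.
pose mu := measure_function_pushforward__canonical__measure_function_Measure
  leb (measurable_translation b).
apply: (@eq_measure_integral _ _ R setT leb mu) => A mA _.
exact: lebesgue_measureD.
Qed.

Lemma ge0_integral_lebesgueZ (a : R) (g : R -> \bar R) : a != 0 ->
  measurable_fun [set: measurableTypeR R] g -> (forall t, (0 <= g t)%E) ->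
  (`|a|%:E * \int[leb]_t g (a * t)%R = \int[leb]_t g t)%E.
Proof.
move=> a0 mg g0.
have /esym := @ge0_integral_pushforward _ _ _ _ R _ (measurable_dilation a) leb
  setT g measurableT mg (fun t _ => g0 t).
rewrite preimage_setT => ->.
pose mu := measure_function_pushforward__canonical__measure_function_Measure
  leb (measurable_dilation a).
pose k := NngNum (normr_ge0 a).
have := @ge0_integral_mscale _ _ R mu setT measurableT k g mg (fun t _ => g0 t).
rewrite /= => <-.
apply: (@eq_measure_integral _ _ R setT leb (mscale k mu)) => A mA _.
exact: lebesgue_measureZ.
Qed.

End affine_1d.

(** * The Lebesgue measure of R^n: Tonelli and linear changes of variables *)

Section lebesgue_rV_theory.
Variable R : realType.
Notation leb := (@lebesgue_measure R).

Lemma consrV0 n (p : 'rV[R]_n * R) : consrV p ord0 ord0 = p.2.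
Proof.
rewrite (_ : ord0 = @lshift 1 n ord0); last exact: val_inj.
by rewrite [LHS](@row_mxEl R 1 1 n) mxE eqxx mulr1n.
Qed.

Lemma consrVS n (p : 'rV[R]_n * R) i : consrV p ord0 (lift ord0 i) = p.1 ord0 i.
Proof.
rewrite (_ : lift ord0 i = @rshift 1 n i); last exact: val_inj.
by rewrite [LHS](@row_mxEr R 1 1 n).
Qed.

Lemma measurable_rV_box n (a b : 'rV[R]_n) :
  measurable [set x : 'rV[R]_n | forall i, a ord0 i <= x ord0 i <= b ord0 i].
Proof.
rewrite (_ : mkset _ = \bigcap_(i in [set: 'I_n])
    ((fun x : 'rV[R]_n => x ord0 i) @^-1` `[a ord0 i, b ord0 i])).
  apply: fin_bigcap_measurable => // i _; rewrite -[X in measurable X]setTI.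
  exact: (@measurable_coor R n i).
apply/seteqP; split=> [x bx i _|x bx i]; first by rewrite /= in_itv /= bx.
by have := bx i Logic.I; rewrite /= in_itv.
Qed.

Lemma lebesgue_rV_sigma_finite n : sigma_finite setT (lebesgue_rV R n).
Proof.
pose B (k : nat) := [set x : 'rV[R]_n |
  forall i, (const_mx (- k%:R) : 'rV[R]_n) ord0 i <= x ord0 i
            <= (const_mx k%:R : 'rV[R]_n) ord0 i].
exists B => [|k].
  apply/esym; rewrite -subTset => x _.
  pose M := \sum_(i < n) `|x ord0 i|.
  exists (Num.Def.archi_bound M) => // i; rewrite !mxE -ler_norml.
  apply: (@le_trans _ _ M); last exact/ltW/archi_boundP/sumr_ge0.
  by rewrite /M (bigD1 i) //= lerDl sumr_ge0.
split; first exact: measurable_rV_box.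
by rewrite lebesgue_rV_box ?ltry // => i; rewrite !mxE ge0_cp //.
Qed.

HB.instance Definition _ n := Measure_isSigmaFinite.Build _ _ _
  (lebesgue_rV R n) (@lebesgue_rV_sigma_finite n).

(** The reals carry two convertible measurable structures; the Lebesgue measure
    lives on [measurableTypeR R], so the measurability of [consrV] is needed
    there too. *)
Lemma measurable_consrV_lebesgue n : @measurable_fun _ _
  ('rV[R]_n * measurableTypeR R)%type 'rV[R]_n.+1 setT (@consrV R n).
Proof. exact: measurable_consrV. Qed.

Local Open Scope ereal_scope.

Lemma ge0_integral_consrV n (g : 'rV[R]_n.+1 -> \bar R) :
  measurable_fun setT g -> (forall x, 0 <= g x) ->
  \int[lebesgue_rV R n.+1]_x g x =
  \int[lebesgue_rV R n \x leb]_p g (consrV p).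
Proof.
move=> mg g0.
exact: (@ge0_integral_pushforward _ _ _ _ R _ (@measurable_consrV_lebesgue n)
  (lebesgue_rV R n \x leb) setT g measurableT mg (fun t _ => g0 t)).
Qed.

(** The measure splits off coordinate 0, which is integrated first here and last
    in [tonelli_consrV2]. *)
Lemma tonelli_consrV1 n (g : 'rV[R]_n.+1 -> \bar R) :
  measurable_fun setT g -> (forall x, 0 <= g x) ->
  \int[lebesgue_rV R n.+1]_x g x =
  \int[lebesgue_rV R n]_y \int[leb]_t g (consrV (y, t)).
Proof.
move=> mg g0; rewrite ge0_integral_consrV //.
apply: (@fubini_tonelli1 _ _ _ _ R (lebesgue_rV R n) leb (g \o @consrV R n)).
  exact: measurableT_comp mg (@measurable_consrV_lebesgue n).
by move=> p; exact: g0.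
Qed.

Lemma tonelli_consrV2 n (g : 'rV[R]_n.+1 -> \bar R) :
  measurable_fun setT g -> (forall x, 0 <= g x) ->
  \int[lebesgue_rV R n.+1]_x g x =
  \int[leb]_t \int[lebesgue_rV R n]_y g (consrV (y, t)).
Proof.
move=> mg g0; rewrite ge0_integral_consrV //.
apply: (@fubini_tonelli2 _ _ _ _ R (lebesgue_rV R n) leb (g \o @consrV R n)).
  exact: measurableT_comp mg (@measurable_consrV_lebesgue n).
by move=> p; exact: g0.
Qed.

Lemma measurable_integral_consrV1 n (g : 'rV[R]_n.+1 -> \bar R) :
  measurable_fun setT g -> (forall x, 0 <= g x) ->
  measurable_fun setT (fun y => \int[leb]_t g (consrV (y, t))).
Proof.
move=> mg g0; apply: (@measurable_fun_fubini_tonelli_F _ _ _ _ R leb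
  (g \o @consrV R n)) => [|p]; last exact: g0.
exact: measurableT_comp mg (@measurable_consrV_lebesgue n).
Qed.

Lemma measurable_integral_consrV2 n (g : 'rV[R]_n.+1 -> \bar R) :
  measurable_fun setT g -> (forall x, 0 <= g x) ->
  measurable_fun [set: measurableTypeR R]
    (fun t => \int[lebesgue_rV R n]_y g (consrV (y, t))).
Proof.
move=> mg g0; apply: (@measurable_fun_fubini_tonelli_G _ _ _ _ R
  (lebesgue_rV R n) (g \o @consrV R n)) => [|p]; last exact: g0.
exact: measurableT_comp mg (@measurable_consrV_lebesgue n).
Qed.

Lemma measurable_consrV_l n (t : R) :
  measurable_fun setT (fun y : 'rV[R]_n => consrV (y, t)).
Proof.
apply: measurable_fun_rVP => i; case: (unliftP ord0 i) => [j|] ->.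
  by under eq_fun do rewrite consrVS; exact: measurable_coor.
by under eq_fun do rewrite consrV0; exact: measurable_cst.
Qed.

Lemma measurable_consrV_r n (y : 'rV[R]_n) :
  measurable_fun setT (fun t : measurableTypeR R => consrV (y, t)).
Proof.
apply: measurable_fun_rVP => i; case: (unliftP ord0 i) => [j|] ->.
  by under eq_fun do rewrite consrVS; exact: measurable_cst.
by under eq_fun do rewrite consrV0; exact: measurable_id.
Qed.

Lemma measurable_affine_rV n m (A : 'M[R]_(n, m)) (b : 'rV[R]_m) :
  measurable_fun setT (fun x : 'rV[R]_n => (x *m A + b)%R).
Proof.
apply: measurable_fun_rVP => i.
under eq_fun do rewrite !mxE.
apply: measurable_funD => //; apply: measurable_sum => j.
by apply: measurable_funM => //; exact: measurable_coor.
Qed.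

(** Induction on the dimension: [tonelli_consrV1] translates one coordinate at a
    time. *)
Lemma ge0_integral_rVD n (b : 'rV[R]_n) (g : 'rV[R]_n -> \bar R) :
  measurable_fun setT g -> (forall x, 0 <= g x) ->
  \int[lebesgue_rV R n]_x g (x + b)%R = \int[lebesgue_rV R n]_x g x.
Proof.
elim: n b g => [|n IHn] b g mg g0.
  by apply: eq_integral => x _; congr g; apply/rowP => -[].
have mgb : measurable_fun setT (fun x : 'rV[R]_n.+1 => g (x + b)%R).
  apply: measurableT_comp => //.
  under eq_fun do rewrite -[X in (X + b)%R]mulmx1.
  exact: measurable_affine_rV.
pose b0 := b ord0 ord0; pose b' : 'rV[R]_n := (\row_i b ord0 (lift ord0 i))%R.
have consD y t : (consrV (y, t) + b = consrV (y + b', t + b0))%R.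
  apply/rowP => i; rewrite mxE; case: (unliftP ord0 i) => [j|] ->.
    by rewrite !consrVS /= !mxE.
  by rewrite !consrV0.
rewrite (tonelli_consrV1 mgb (fun=> g0 _)).
under eq_integral do under eq_integral do rewrite consD.
transitivity (\int[lebesgue_rV R n]_y \int[leb]_t g (consrV (y + b', t)%R)).
  apply: eq_integral => y _.
  apply: (@ge0_integral_lebesgueD R b0
    (fun t => g (consrV (y + b', t)%R))) => //.
  exact: measurableT_comp mg (measurable_consrV_r _).
rewrite [RHS](tonelli_consrV1 mg g0).
apply: (IHn b' (fun y => \int[leb]_t g (consrV (y, t)))).
  exact: measurable_integral_consrV1.
move=> y /=. apply: integral_ge0 => t _; exact: g0.
Qed.

(** Stated for nonnegative functions, to which Tonelli applies directly;
    [integral_affine_rV] extends the formula to integrable functions. *)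
Definition change_of_variables n (A : 'M[R]_n) : Prop :=
  forall g : 'rV[R]_n -> \bar R,
  measurable_fun setT g -> (forall x, 0 <= g x) ->
  `|\det A|%:E * \int[lebesgue_rV R n]_x g (x *m A)%R =
  \int[lebesgue_rV R n]_x g x.

Lemma measurable_mulmxr n m (A : 'M[R]_(n, m)) :
  measurable_fun setT (fun x : 'rV[R]_n => (x *m A)%R).
Proof.
by under eq_fun do rewrite -[(_ *m A)%R]addr0; exact: measurable_affine_rV.
Qed.

Lemma change_of_variablesM n (A B : 'M[R]_n) :
  change_of_variables A -> change_of_variables B ->
  change_of_variables (A *m B)%R.
Proof.
move=> cA cB g mg g0; rewrite det_mulmx normrM mulrC EFinM -muleA.
under eq_integral do rewrite mulmxA.
have -> := cA (fun x : 'rV[R]_n => g (x *m B)%R); first exact: cB.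
- exact: measurableT_comp mg (measurable_mulmxr _).
- by move=> x.
Qed.

Lemma mul_consrV_block n (y : 'rV[R]_n) (t : R) (a : 'M[R]_1) (r : 'rV[R]_n)
    (c : 'cV[R]_n) (D : 'M[R]_n) :
  (consrV (y, t) *m (block_mx a r c D : 'M[R]_n.+1) =
   consrV (t *: r + y *m D, t * a ord0 ord0 + (y *m c) ord0 ord0))%R.
Proof.
rewrite [LHS](@mul_row_block R 1 1 n 1 n) /consrV /=.
apply: (f_equal2 (@row_mx R 1 1 n)).
  by apply/matrixP => i j; rewrite !ord1 !mxE big_ord1 !mxE eqxx !mulr1n.
by rewrite mul_scalar_mx.
Qed.

(** The shear fixes all coordinates but coordinate 0, which it translates by a
    function of the others. *)
Lemma change_of_variables_lower_shear n (c : 'cV[R]_n) :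
  change_of_variables (block_mx (1%:M : 'M[R]_1) 0 c 1%:M : 'M[R]_n.+1)%R.
Proof.
move=> g mg g0; rewrite (@det_lblock R 1 n) !det1 mulr1 normr1 mul1e.
rewrite (tonelli_consrV1 (measurableT_comp mg (measurable_mulmxr _))
  (fun=> g0 _)).
rewrite [RHS](tonelli_consrV1 mg g0); apply: eq_integral => y _.
under eq_integral do
  rewrite /= mul_consrV_block scaler0 add0r mulmx1 mxE eqxx mulr1.
apply: (@ge0_integral_lebesgueD R _ (fun t => g (consrV (y, t)))) => [|s];
  last exact: g0.
exact: measurableT_comp mg (measurable_consrV_r _).
Qed.

(** The shear fixes coordinate 0 and translates the others by a multiple of it,
    hence the opposite order of integration. *)
Lemma change_of_variables_upper_shear n (r : 'rV[R]_n) :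
  change_of_variables (block_mx (1%:M : 'M[R]_1) r 0 1%:M : 'M[R]_n.+1)%R.
Proof.
move=> g mg g0; rewrite (@det_ublock R 1 n) !det1 mulr1 normr1 mul1e.
rewrite (tonelli_consrV2 (measurableT_comp mg (measurable_mulmxr _))
  (fun=> g0 _)).
rewrite [RHS](tonelli_consrV2 mg g0); apply: eq_integral => t _.
under eq_integral do
  rewrite /= mul_consrV_block mulmx0 !mxE eqxx mulr1 addr0 mulmx1 addrC.
apply: (@ge0_integral_rVD n _ (fun y => g (consrV (y, t)))) => [|s];
  last exact: g0.
exact: measurableT_comp mg (measurable_consrV_l _).
Qed.

Lemma change_of_variables_block_diag n (a : R) (D : 'M[R]_n) :
  a != 0%R -> change_of_variables D ->
  change_of_variables (block_mx (a%:M : 'M[R]_1) 0 0 D : 'M[R]_n.+1)%R.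
Proof.
move=> a0 cD g mg g0; rewrite (@det_ublock R 1 n) det_scalar1 normrM EFinM.
have mgA : measurable_fun setT (fun x : 'rV[R]_n.+1 =>
    g (x *m (block_mx (a%:M : 'M[R]_1) 0 0 D : 'M[R]_n.+1))%R).
  exact: measurableT_comp mg (measurable_mulmxr _).
rewrite (tonelli_consrV2 mgA (fun=> g0 _)) [RHS](tonelli_consrV2 mg g0) -muleA.
pose G t := \int[lebesgue_rV R n]_y g (consrV (y, t)).
have mG : measurable_fun [set: measurableTypeR R] G.
  exact: measurable_integral_consrV2.
have G0 t : 0 <= G t by apply: integral_ge0 => y _; exact: g0.
rewrite -[RHS](@ge0_integral_lebesgueZ R a G) //; congr (_ * _).
rewrite -ge0_integralZl //; last 2 first.
  by apply: measurable_integral_consrV2 mgA _ => x; exact: g0.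
  by move=> t _; apply: integral_ge0 => y _; exact: g0.
apply: eq_integral => t _; rewrite /G.
rewrite -[RHS](cD (fun y => g (consrV (y, a * t)%R))); last 2 first.
- exact: measurableT_comp mg (measurable_consrV_l _).
- by move=> y; exact: g0.
congr (_ * _); apply: eq_integral => y _; congr g.
by rewrite mul_consrV_block scaler0 add0r mulmx0 !mxE eqxx mulr1n addr0 mulrC.
Qed.

(** With a nonzero pivot a, and a matrix with first row (a, r), first column
    (a, c) and remaining block D, block elimination reads
    [[a, r], [c, D]] =
      [[1, 0], [c/a, 1]] [[a, 0], [0, D - c r / a]] [[1, r/a], [0, 1]].
    A zero pivot is made nonzero by first adding to row 0 a row whose first
    entry is nonzero, which is multiplication by an upper shear. *)
Lemma change_of_variables_unit n (A : 'M[R]_n) :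
  A \in unitmx -> change_of_variables A.
Proof.
elim: n A => [|n IHn] A uA.
  move=> g mg g0; rewrite det_mx00 normr1 mul1e.
  by apply: eq_integral => x _; congr g; apply/rowP => -[].
have pivot (B : 'M[R]_(1 + n)) : B \in unitmx -> B ord0 ord0 != 0%R ->
    change_of_variables (B : 'M[R]_n.+1).
  move=> uB; set a := B ord0 ord0 => a0.
  pose r : 'rV[R]_n := ursubmx B; pose c : 'cV[R]_n := dlsubmx B.
  pose D : 'M[R]_n := drsubmx B.
  have aE : ulsubmx B = (a%:M)%R.
    apply/matrixP => i j; rewrite !ord1 !mxE eqxx mulr1n.
    by congr (B _ _); exact: val_inj.
  pose D' := (D - a^-1 *: (c *m r))%R.
  have BE : (B = block_mx 1%:M 0 (a^-1 *: c) 1%:M *m block_mx a%:M 0 0 D'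
      *m block_mx 1%:M (a^-1 *: r) 0 1%:M)%R.
    rewrite !mulmx_block !(mul0mx, mulmx0, mul1mx, mulmx1, addr0, add0r).
    rewrite mul_scalar_mx scalerA divff // scale1r -scalemxAl mul_mx_scalar.
    rewrite scalerA mulVf // scale1r -scalemxAr addrC /D' subrK.
    by rewrite -[LHS]submxK aE.
  have uD' : D' \in unitmx.
    move: uB; rewrite BE !unitmx_mul => /andP[/andP[_ +] _].
    by rewrite !unitmxE det_ublock unitrM => /andP[].
  rewrite BE; apply: change_of_variablesM;
    last exact: change_of_variables_upper_shear.
  apply: change_of_variablesM; first exact: change_of_variables_lower_shear.
  by apply: change_of_variables_block_diag => //; exact: IHn.
have [A00|] := eqVneq (A ord0 ord0) 0%R; last exact: pivot.
pose c : 'cV[R]_n := dlsubmx (A : 'M[R]_(1 + n)).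
have [i ci] : exists i, c i ord0 != 0%R.
  apply/existsP; apply: contraTT uA => /existsPn c0.
  rewrite unitmxE; suff -> : (\det A = 0)%R by rewrite unitr0.
  rewrite (expand_det_col A ord0) big1 // => i _.
  case: (unliftP ord0 i) => [j|] ->; last by rewrite A00 mul0r.
  have := c0 j; rewrite negbK !mxE => /eqP cj.
  rewrite (_ : A _ _ = 0)%R ?mul0r // -[RHS]cj.
  by congr (A _ _); exact: val_inj.
pose w : 'rV[R]_n := delta_mx ord0 i.
pose S (w : 'rV[R]_n) : 'M[R]_(1 + n) := block_mx 1%:M w 0 1%:M.
have SK : (S (- w) *m S w = 1%:M)%R.
  rewrite mulmx_block !(mul0mx, mulmx0, mul1mx, mulmx1, addr0, add0r) subrr.
  by rewrite -scalar_mx_block.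
have -> : A = (S (- w) *m (S w *m (A : 'M[R]_(1 + n))))%R.
  by rewrite mulmxA SK mul1mx.
apply: change_of_variablesM; first exact: change_of_variables_upper_shear.
apply: pivot; first by rewrite unitmx_mul uA andbT (mulmx1_unit SK).2.
rewrite -[A](@submxK R 1 n 1 n) mulmx_block.
rewrite (_ : ord0 = @lshift 1 n ord0); last exact: val_inj.
rewrite block_mxEul mxE mul1mx -/c.
rewrite [X in (X + _)%R](_ : _ = 0%R); last first.
  by rewrite -[RHS]A00 !mxE; congr (A _ _); exact: val_inj.
by rewrite add0r -rowE mxE.
Qed.

End lebesgue_rV_theory.

(** The nonnegative case applies to the positive and the negative parts. *)
Lemma integral_affine_rV (R : realType) n (A : 'M[R]_n) (b : 'rV[R]_n)
    (g : 'rV[R]_n -> \bar R) : A \in unitmx -> measurable_fun setT g ->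
  (lebesgue_rV R n).-integrable setT (fun c => g (b + c *m A)) ->
  (\int[lebesgue_rV R n]_y g y =
   `|\det A|%:E * \int[lebesgue_rV R n]_c g (b + c *m A)%R)%E.
Proof.
move=> uA mg ig.
have ge0_case (k : 'rV[R]_n -> \bar R) : measurable_fun setT k ->
    (forall y, (0 <= k y)%E) ->
    (\int[lebesgue_rV R n]_y k y =
     `|\det A|%:E * \int[lebesgue_rV R n]_c k (b + c *m A)%R)%E.
  move=> mk k0; rewrite -(ge0_integral_rVD b mk k0).
  rewrite -(change_of_variables_unit uA) //; last first.
    apply: measurableT_comp mk _.
    by under eq_fun do rewrite -[X in X + b]mulmx1; exact: measurable_affine_rV.
  by congr (_ * _)%E; apply: eq_integral => c _; rewrite addrC.
rewrite integralE [X in (_ * X)%E]integralE.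
rewrite (ge0_case (g^\+)%E (measurable_funepos mg) (funepos_ge0 g)).
rewrite (ge0_case (g^\-)%E (measurable_funeneg mg) (funeneg_ge0 g)).
rewrite [RHS]muleBr //.
  congr (_ * _ - _ * _)%E; apply: eq_integral => c _.
    by rewrite !funeposE.
  by rewrite !funenegE.
rewrite fin_num_adde_defl // fin_numN.
exact: (@integrable_neg_fin_num _ _ _ _ _ measurableT _ ig).
Qed.

(** * Measurability of continuous functions on R^n *)

(** The sigma-algebra is generated by the coordinates, and an open set is the
    countable union of the cubes with rational centre and radius 1/(k+1) that it
    contains. *)
Lemma open_measurable_rV (R : realType) n (U : set 'rV[R]_n) :
  open U -> measurable U.
Proof.
move=> oU.
pose B (i : {ffun 'I_n -> rat} * nat) := [set x : 'rV[R]_n |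
  forall j, `|x ord0 j - ratr (i.1 j)| < i.2.+1%:R^-1].
have mB i : measurable (B i).
  rewrite (_ : B i = \bigcap_(j in [set: 'I_n]) ((fun x : 'rV[R]_n => x ord0 j)
      @^-1` `](ratr (i.1 j) - i.2.+1%:R^-1), (ratr (i.1 j) + i.2.+1%:R^-1)[)).
    apply: fin_bigcap_measurable => // j _; rewrite -[X in measurable X]setTI.
    exact: (@measurable_coor R n j).
  apply/seteqP; split=> [x Bx j _|x Bx j].
    by rewrite /= in_itv /= -ltr_distl; exact: Bx.
  by have := Bx j Logic.I; rewrite /= in_itv /= -ltr_distl.
rewrite (_ : U = \bigcup_(i in [set i | B i `<=` U]) B i).
  rewrite bigcup_mkcond; apply: countable_bigcupT_measurable.
    exact: countableP.
  by move=> i; case: ifP.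
apply/seteqP; split=> [x Ux|x [i /= BU Bx]]; last exact: BU.
have /nbhs_ballP[e /= e0 eU] : nbhs x U by exact: open_nbhs_nbhs.
have e20 : 0 < e / 2 by rewrite divr_gt0.
(* A cube of half side below e / 2 that contains x lies in the ball of radius
   e. *)
have [k ke] : exists k, k.+1%:R^-1 < e / 2 :> R.
  exists (Num.Def.archi_bound (e / 2)^-1).
  rewrite invf_plt ?posrE //; apply: lt_trans (archi_boundP _) _.
    by rewrite invr_ge0 ltW.
  by rewrite ltr_nat.
have /choice[q qx] : forall j, exists q : rat,
    `|x ord0 j - ratr q| < k.+1%:R^-1.
  move=> j; have [q] := @rat_in_itvoo R (x ord0 j - k.+1%:R^-1)
    (x ord0 j + k.+1%:R^-1) ltac:(by rewrite ltrD2l gtrN ?invr_gt0).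
  by rewrite in_itv /= -ltr_distl distrC; exists q.
exists ([ffun j => q j], k) => [y By|j]; last by rewrite ffunE.
apply: eU; split=> // i j; rewrite ord1.
have := By j; rewrite ffunE /= => yq.
rewrite /ball /=; apply: le_lt_trans (ler_distD (ratr (q j)) _ _) _.
rewrite [ltRHS](splitr e); apply: ltrD; first exact: lt_trans (qx j) ke.
by rewrite distrC; exact: lt_trans yq ke.
Qed.

Lemma continuous_measurable_rV (R : realType) n (f : 'rV[R]_n -> R) :
  continuous f -> measurable_fun setT f.
Proof.
move=> /continuousP cf; apply: (measurability _ (RGenOpens.measurableE R)).
move=> _ [_ [a [b ->] <-]]; rewrite setTI; apply: open_measurable_rV.
exact/cf/interval_open.
Qed.

(** * Integration along rays *)

Section ray_1d.
Variable R : realType.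
Notation leb := (@lebesgue_measure R).

(** A function that vanishes before a sees only a segment of a ray; this makes
    integrals over rays ordinary integrals over segments. *)
Lemma restrict_ray (g : R -> R) (a b : R) : (forall t, t < a -> g t = 0) ->
  g \_ `]-oo, b] = g \_ `[a, b].
Proof.
move=> g0; apply/funext => t; rewrite !patchE !mem_setE !in_itv /=.
by have [/g0 ->|] := ltP t a; [rewrite if_same|].
Qed.

Lemma integrable_ray (g : R -> R) (a b : R) : continuous g ->
  (forall t, t < a -> g t = 0) -> leb.-integrable `]-oo, b] (EFin \o g).
Proof.
move=> cg g0; apply: (iffRL (@integrable_mkcond _ _ R leb `]-oo, b] _ _)) => //.
rewrite restrict_EFin (restrict_ray b g0) -restrict_EFin.
apply: (iffLR (@integrable_mkcond _ _ R leb `[a, b] _ _)) => //.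
apply: continuous_compact_integrable.
  exact: segment_compact.
exact: continuous_subspaceT.
Qed.

Lemma Rintegral_ray (g : R -> R) (a b : R) : (forall t, t < a -> g t = 0) ->
  \int[leb]_(t in `]-oo, b]) g t = \int[leb]_(t in `[a, b]) g t.
Proof.
by move=> g0; rewrite Rintegral_mkcond (restrict_ray b g0) -Rintegral_mkcond.
Qed.

Lemma Rintegral_ray_shift (g : R -> R) (a h : R) : continuous g ->
  (forall t, t < a -> g t = 0) ->
  \int[leb]_(t in `]-oo, 0]) g (t + h) = \int[leb]_(t in `]-oo, h]) g t.
Proof.
move=> cg g0; rewrite /Rintegral; congr fine; apply/esym.
have phiE : (fun t : R => t + h) @^-1` `]-oo, h] = `]-oo, 0]%classic.
  by apply/seteqP; split=> t /=; rewrite !in_itv /= gerDr.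
have cgh : continuous (fun t => g (t + h)).
  move=> t; apply: (@continuous_comp _ _ _ (fun t => t + h) g); last exact: cg.
  by apply: cvgD; [exact: cvg_id|exact: cvg_cst].
have := @integral_pushforward _ _ _ _ R _ (measurable_translation h) leb
  `]-oo, h] (EFin \o g).
rewrite phiE => <- //.
- pose mu := measure_function_pushforward__canonical__measure_function_Measure
    leb (measurable_translation h).
  apply: (@eq_measure_integral _ _ R _ mu leb) => A mA _.
  by apply/esym; exact: lebesgue_measureD.
- by apply/measurable_EFinP; exact: continuous_measurable_fun.
- apply: (@integrable_ray _ (a - h)) => // t; rewrite ltrBrDr; exact: g0.
Qed.

End ray_1d.

Section ray_integral.
Variables (R : realType) (n : nat).
Notation leb := (@lebesgue_measure R).
Implicit Types (f : 'rV[R]_n -> R) (u x : 'rV[R]_n) (w : 'cV[R]_n).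

Definition ray_integral u f x : R :=
  \int[leb]_(t in `]-oo, 0]) f (x + t *: u).

Definition lform w x : R := (x *m w) ord0 ord0.

Lemma lformD w x y : lform w (x + y) = lform w x + lform w y.
Proof. by rewrite /lform mulmxDl mxE. Qed.

Lemma lformZ w a x : lform w (a *: x) = a * lform w x.
Proof. by rewrite /lform -scalemxAl mxE. Qed.

Lemma lform_continuous w : continuous (lform w).
Proof.
rewrite /lform; under eq_fun do rewrite mxE.
apply: continuous_big => [|i _]; first exact: add_continuous.
have ci : continuous (fun x : 'rV[R]_n => x ord0 i * w i ord0).
  move=> x; apply: continuousM; first exact: coord_continuous.
  exact: cst_continuous.
exact: ci.
Qed.

(** The class in which ray integrals are iterated. Compact support is lost after
    one integration, but being zero on a half-space [lform w x < M] is kept by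
    every direction along which [lform w] increases. *)
Definition half_supported w f : Prop :=
  continuous f /\ exists M, forall x, lform w x < M -> f x = 0.

Lemma line_continuous f x u : continuous f ->
  continuous (fun t : R => f (x + t *: u)).
Proof.
move=> cf; have cl : continuous (fun t : R => x + t *: u).
  move=> t; have := @scalel_continuous R 'rV[R]_n u t.
  exact: (@cvgD _ _ _ (nbhs t) _ (cst x) (fun t : R => t *: u) _ _ (cvg_cst x)).
by move=> t; exact: continuous_comp (cl t) (cf _).
Qed.

Lemma line_vanish w f M x u : lform w u = 1 ->
  (forall y, lform w y < M -> f y = 0) ->
  forall t, t < M - lform w x -> f (x + t *: u) = 0.
Proof.
by move=> wu f0 t tM; apply: f0; rewrite lformD lformZ wu mulr1 addrC -ltrBrDr.
Qed.

Lemma integrable_ray_line w f x u b : lform w u = 1 -> half_supported w f ->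
  leb.-integrable `]-oo, b] (EFin \o (fun t => f (x + t *: u))).
Proof.
move=> wu [cf [M f0]]; apply: integrable_ray (line_vanish wu f0).
exact: line_continuous.
Qed.

(** Moving the base point along u changes only the end point of the ray: this is
    what brings the fundamental theorem of calculus to bear. *)
Lemma ray_integralD w f x u h : lform w u = 1 -> half_supported w f ->
  ray_integral u f (x + h *: u) =
  \int[leb]_(t in `]-oo, h]) f (x + t *: u).
Proof.
move=> wu [cf [M f0]].
rewrite -(Rintegral_ray_shift h (line_continuous cf) (line_vanish wu f0)).
by apply: eq_Rintegral => t _; rewrite -addrA -scalerDl [h + t]addrC.
Qed.

Lemma derive_ray_integral w f u x : lform w u = 1 -> half_supported w f ->
  derivable (ray_integral u f) x u /\ 'D_u (ray_integral u f) x = f x.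
Proof.
move=> wu hf; pose g t := f (x + t *: u).
have cg : continuous g by apply: line_continuous; case: hf.
have := @continuous_FTC1 R g -oo%O 0 1 ltr01 (integrable_ray_line x 1 wu hf)
  (ltNyr _) (cg 0).
rewrite derive1E /derivable /derive.
have -> : (fun h => h^-1 *: ((ray_integral u f \o shift x) (h *: u)
      - ray_integral u f x)) =
    (fun h => h^-1 *: (((fun y => \int[leb]_(t in `]-oo, y]) g t) \o shift 0)
      (h *: 1) - \int[leb]_(t in `]-oo, 0]) g t)).
  apply/funext => h /=; congr (_ *: (_ - _)).
  by rewrite addrC (ray_integralD x h wu hf) addr0 [h *: 1]mulr1.
by rewrite /g scale0r addr0.
Qed.

Lemma ray_integral_vanish w f u M : lform w u = 1 ->
  (forall y, lform w y < M -> f y = 0) ->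
  forall x, lform w x < M -> ray_integral u f x = 0.
Proof.
move=> wu f0 x xM; rewrite /ray_integral.
transitivity (\int[leb]_(t in `]-oo, 0]) (0 : R)); last first.
  by rewrite /Rintegral integral0.
apply: eq_Rintegral => t; rewrite inE /= in_itv /= => t0.
by apply: f0; rewrite lformD lformZ wu mulr1 (le_lt_trans _ xM) // gerDl.
Qed.

(** Continuity holds because, near a point, the integrals are over a common
    segment, on which the integrand depends on the base point uniformly, by
    compactness of the segment. *)
Lemma half_supported_ray_integral w f u : lform w u = 1 ->
  half_supported w f -> half_supported w (ray_integral u f).
Proof.
move=> wu [cf [M f0]]; split; last first.
  by exists M; exact: ray_integral_vanish.
move=> x; apply: (iffRL (@cvgrPdist_le _ _ _ (nbhs x) _ _ _)) => /= e e0.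
(* For all y with lform w y < lform w x + 1 the integrand vanishes before -K, so
   that near x all the ray integrals are integrals over the same segment. *)
pose K := `|M - (lform w x + 1)|.
have K0 : 0 <= K by exact: normr_ge0.
have JE y : lform w y < lform w x + 1 ->
    ray_integral u f y = \int[leb]_(t in `[- K, 0]) f (y + t *: u).
  move=> yx; apply: Rintegral_ray => t tK; apply: (line_vanish wu f0).
  apply: lt_le_trans tK _; apply: le_trans (_ : M - (lform w x + 1) <= _).
    by rewrite lerNl /K ler_normr lexx orbT.
  by rewrite lerD2l lerN2 ltW.
have d0 : 0 < e / (K + 1) by rewrite divr_gt0 // ltr_wpDl.
have near_x : \forall y \near nbhs x, lform w y < lform w x + 1.
  have := @cvgr_lt _ _ (nbhs x) _ _ _ (@lform_continuous w x).
  by apply; rewrite ltrDl.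
have cp (t : R) :
    {for (t, x), continuous (fun z : R * 'rV[R]_n => f (z.2 + z.1 *: u))}.
  have cl : {for (t, x), continuous (fun z : R * 'rV[R]_n => z.2 + z.1 *: u)}.
    have H2 : (fun z : R * 'rV[R]_n => z.1 *: u) @ nbhs (t, x) --> t *: u.
      apply: cvgZr_tmp; exact: cvg_fst.
    exact: (@cvgD _ _ _ (nbhs (t, x)) _ _ _ _ _ cvg_snd H2).
  exact: continuous_comp cl (cf _).
have near_u : \forall y \near nbhs x, forall t, `[- K, 0]%classic t ->
    `|f (x + t *: u) - f (y + t *: u)| < e / (K + 1).
  have /compact_near_coveringP/(_ _ (nbhs x)
    (fun y t => `|f (x + t *: u) - f (y + t *: u)| < e / (K + 1)) _)
    := @segment_compact R (- K) 0.
  apply => t _.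
  have d20 : 0 < e / (K + 1) / 2 by rewrite divr_gt0.
  have N1 : \forall z \near filter_prod (nbhs t) (nbhs x),
      `|f (x + t *: u) - f (z.2 + z.1 *: u)| < e / (K + 1) / 2.
    exact: (iffLR (@cvgrPdist_lt _ _ _ (nbhs (t, x)) _ _ _) (cp t) _ d20).
  have N2 : \forall s \near nbhs t,
      `|f (x + t *: u) - f (x + s *: u)| < e / (K + 1) / 2.
    exact: (iffLR (@cvgrPdist_lt _ _ _ (nbhs t) _ _ _)
      (@line_continuous f x u cf t) _ d20).
  have N3 : \forall z \near filter_prod (nbhs t) (nbhs x),
      `|f (x + t *: u) - f (x + z.1 *: u)| < e / (K + 1) / 2.
    exact: cvg_fst N2.
  apply: filterS (filterI N1 N3) => -[s y] [] /= H1 H2.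
  rewrite [ltRHS]splitr (le_lt_trans (ler_distD (f (x + t *: u)) _ _)) //.
  by rewrite ltrD // distrC.
apply: filterS (filterI near_x near_u) => y [yx yu].
rewrite (JE x) ?ltrDl // (JE y) //.
have int_f z : leb.-integrable `[- K, 0] (EFin \o (fun t => f (z + t *: u))).
  apply: continuous_compact_integrable; first exact: segment_compact.
  exact/continuous_subspaceT/line_continuous.
rewrite -(RintegralB _ (int_f x) (int_f y)) //.
have int_B : leb.-integrable `[- K, 0]
    (EFin \o (fun t => f (x + t *: u) - f (y + t *: u))).
  by have := integrableB _ (int_f x) (int_f y); exact.
apply: le_trans (le_normr_Rintegral _ int_B) _ => //.
apply: (@le_trans _ _ (\int[leb]_(t in `[- K, 0]) (e / (K + 1)))).
  apply: le_Rintegral => //.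
  - exact: (integrable_norm int_B).
  - apply: continuous_compact_integrable; first exact: segment_compact.
    by apply: continuous_subspaceT => t; exact: cvg_cst.
  - by move=> t /yu /ltW.
rewrite Rintegral_cst //= lebesgue_measure_itv /= lte_fin.
case: ifPn => [_|_] /=; last by rewrite mulr0 ltW.
rewrite sub0r opprK mulrAC ler_pdivrMr ?ltr_wpDl // ler_pM2l // lerDl.
exact: ler01.
Qed.

End ray_integral.

(** * Integration over the nonpositive orthant *)

Section orthant.
Variable R : realType.
Notation leb := (@lebesgue_measure R).

Definition neg_orthant n : set 'rV[R]_n := [set c | forall i, c ord0 i <= 0].

Lemma measurable_neg_orthant n : measurable (@neg_orthant n).
Proof.
rewrite (_ : @neg_orthant n = \bigcap_(i in [set: 'I_n])
    ((fun x : 'rV[R]_n => x ord0 i) @^-1` `]-oo, 0])).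
  apply: fin_bigcap_measurable => // i _; rewrite -[X in measurable X]setTI.
  exact: (@measurable_coor R n i).
apply/seteqP; split=> [x bx i _|x bx i]; first by rewrite /= in_itv /= bx.
by have := bx i Logic.I; rewrite /= in_itv.
Qed.

Lemma neg_orthant_consrV n (p : 'rV[R]_n * R) :
  neg_orthant (consrV p) <-> neg_orthant p.1 /\ p.2 <= 0.
Proof.
split=> [cp|[p1 p2] i].
  by split=> [i|]; [rewrite -consrVS|rewrite -consrV0]; exact: cp.
by case: (unliftP ord0 i) => [j|] ->; rewrite ?consrVS ?consrV0.
Qed.

Definition lincomb m n (v : n.-tuple 'rV[R]_m) (c : 'rV[R]_n) : 'rV[R]_m :=
  \sum_(i < n) c ord0 i *: tnth v i.

Lemma lincomb_continuous m n (v : n.-tuple 'rV[R]_m) : continuous (lincomb v).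
Proof.
apply: continuous_big => [|i _]; first exact: add_continuous.
have ci : continuous (fun c : 'rV[R]_n => c ord0 i *: tnth v i).
  move=> c; have := @coord_continuous R 1 n ord0 i c.
  exact: (@cvgZr_tmp _ _ _ (nbhs c) _ _ _ _).
exact: ci.
Qed.

Lemma lincomb_consrV m n (u : 'rV[R]_m) (v : n.-tuple 'rV[R]_m) c t :
  lincomb [tuple of u :: v] (consrV (c, t)) = t *: u + lincomb v c.
Proof.
rewrite /lincomb big_ord_recl consrV0 tnth0; congr (_ + _).
by apply: eq_bigr => i _; rewrite consrVS tnthS.
Qed.

Lemma lform_lincomb m n (w : 'cV[R]_m) (v : n.-tuple 'rV[R]_m) c :
  (forall i, lform w (tnth v i) = 1) ->
  lform w (lincomb v c) = \sum_(i < n) c ord0 i.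
Proof.
move=> wv; rewrite /lform mulmx_suml summxE; apply: eq_bigr => i _.
by rewrite -/(lform w _) lformZ wv mulr1.
Qed.

Lemma lincomb_shift_continuous m n (f : 'rV[R]_m -> R)
    (v : n.-tuple 'rV[R]_m) x :
  continuous f -> continuous (fun c => f (x + lincomb v c)).
Proof.
move=> cf c; have cl : {for c, continuous (fun c => x + lincomb v c)}.
  have := @lincomb_continuous m n v c.
  exact: (@cvgD _ _ _ (nbhs c) _ (cst x) _ _ _ (cvg_cst x)).
exact: continuous_comp cl (cf _).
Qed.

(** On the orthant the integrand vanishes unless all coordinates are at least
    -K = - |M - lform w x|: by [lform_lincomb] the sum of the coordinates, which
    are nonpositive, is the variation of [lform w]. So the integral is that of a
    continuous function over a box. *)
Lemma integrable_orthant m n (w : 'cV[R]_m) (v : n.-tuple 'rV[R]_m) f x :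
  (forall i, lform w (tnth v i) = 1) -> half_supported w f ->
  (lebesgue_rV R n).-integrable (@neg_orthant n)
    (EFin \o (fun c => f (x + lincomb v c))).
Proof.
move=> wv [cf [M f0]]; pose K := `|M - lform w x|.
pose a : 'rV[R]_n := const_mx (- K); pose b : 'rV[R]_n := 0.
pose box := [set c : 'rV[R]_n | forall i, a ord0 i <= c ord0 i <= b ord0 i].
have mbox : measurable box by exact: measurable_rV_box.
have cfv := @lincomb_shift_continuous m n f v x cf.
apply: (iffRL (@integrable_mkcond _ _ R (lebesgue_rV R n) _ _ _)).
  exact: measurable_neg_orthant.
have -> : (EFin \o (fun c => f (x + lincomb v c))) \_ (@neg_orthant n) =
    (EFin \o (fun c => f (x + lincomb v c))) \_ box.
  apply/funext => c; rewrite !patchE.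
  case: ifPn => [/set_mem co|/negP co]; last first.
    case: ifPn => // /set_mem cb; exfalso; apply: co; apply/mem_set => i.
    by have /andP[_] := cb i; rewrite mxE.
  case: ifPn => // cb; congr EFin; apply: f0.
  rewrite lformD lform_lincomb // addrC -ltrBrDr.
  have [i] : exists i, c ord0 i < - K.
    apply/not_existsP => cK; move/negP: cb; apply; apply/mem_set => i.
    by rewrite !mxE co andbT leNgt; apply/negP => ?; exact: (cK i).
  move=> ciK; rewrite (bigD1 i) //=.
  apply: le_lt_trans (_ : c ord0 i < _); first by rewrite gerDl sumr_le0.
  by rewrite (lt_le_trans ciK) // lerNl ler_normr lexx orbT.
apply: (iffLR (@integrable_mkcond _ _ R (lebesgue_rV R n) _ _ _)) => //.
apply: measurable_bounded_integrable => //.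
- have ab i : a ord0 i <= b ord0 i by rewrite !mxE oppr_le0 normr_ge0.
  by have := lebesgue_rV_box ab; rewrite -/box /= => ->; rewrite ltry.
- by apply: measurable_funTS; exact: continuous_measurable_rV.
- have /compact_bounded[N [_ mrt]] :
      compact ((fun c => f (x + lincomb v c)) @` box).
    apply: continuous_compact; first exact: continuous_subspaceT.
    rewrite (_ : box = [set c | forall i, `[- K, 0]%classic (c ord0 i)]).
      apply: (@rV_compact R n (fun=> `[- K, 0]%classic)) => _.
      exact: segment_compact.
    by apply/seteqP; split=> c bc i; have := bc i; rewrite /= in_itv /= !mxE.
  exists N; split; rewrite ?num_real // => N' NN' c bc.
  by apply: mrt NN' _ _; exists c.
Qed.

(** Fubini splits off the coordinate of the first vector, whose ray integral is
    then the function of the induction hypothesis; hence [foldl], which makes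
    the first vector the innermost integral. *)
Lemma integral_orthant m n (w : 'cV[R]_m) (v : n.-tuple 'rV[R]_m) f x :
  (forall i, lform w (tnth v i) = 1) -> half_supported w f ->
  (\int[lebesgue_rV R n]_(c in @neg_orthant n) (f (x + lincomb v c))%:E =
   (foldl (fun g u => ray_integral u g) f v x)%:E)%E.
Proof.
elim: n v f => [|n IHn] v f wv hf.
  rewrite [LHS]integral_dirac //; last 2 first.
  - exact: measurable_neg_orthant.
  - apply/measurable_EFinP; apply: measurable_funTS.
    apply: continuous_measurable_rV.
    by apply: lincomb_shift_continuous; case: hf.
  rewrite diracE mem_set ?mul1e; last by case.
  by rewrite /lincomb big_ord0 addr0 (tuple0 v).
case/tupleP: v wv => u v wv.
have wu : lform w u = 1 by have := wv ord0; rewrite tnth0.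
have wv' i : lform w (tnth v i) = 1 by have := wv (lift ord0 i); rewrite tnthS.
pose h := (fun c => f (x + lincomb [tuple of u :: v] c)) \_ (@neg_orthant n.+1).
have ih : (lebesgue_rV R n.+1).-integrable setT (EFin \o h).
  rewrite /h -restrict_EFin.
  apply: (iffLR (@integrable_mkcond _ _ R (lebesgue_rV R n.+1) _ _ _)).
    exact: measurable_neg_orthant.
  exact: integrable_orthant.
have mh := measurable_int _ ih.
have ihc : (lebesgue_rV R n \x leb)%E.-integrable setT
    (EFin \o h \o @consrV R n).
  apply/integrableP; split.
    exact: measurableT_comp mh (@measurable_consrV_lebesgue R n).
  have /integrableP[_] := ih.
  by rewrite ge0_integral_consrV //; exact: measurableT_comp.
rewrite integral_mkcond restrict_EFin -/h.
transitivity (\int[lebesgue_rV R n \x leb]_p ((EFin \o h) (consrV p)))%E.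
  have := @integral_pushforward _ _ _ _ R _ (@measurable_consrV_lebesgue R n)
    (lebesgue_rV R n \x leb)%E setT (EFin \o h) mh.
  rewrite preimage_setT => /(_ ihc measurableT); exact.
rewrite -(integral12_prod_meas1 ihc) /=.
rewrite -(IHn v (ray_integral u f)) //; last exact: half_supported_ray_integral.
rewrite [RHS]integral_mkcond; apply: eq_integral => c _.
rewrite /fubini_F patchE; case: ifPn => [/set_mem co|/negP co]; last first.
  rewrite integral0_eq // => t _ /=.
  rewrite /h patchE ifN //; apply/negP => /set_mem /neg_orthant_consrV[].
  by move=> /= cn; case: co; exact/mem_set.
transitivity (\int[leb]_(t in `]-oo, 0%R])
    ((fun t => f (x + lincomb v c + t *: u)) t)%:E)%E.
  rewrite [RHS]integral_mkcond; apply: eq_integral => t _ /=.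
  rewrite restrict_EFin /= /h !patchE lincomb_consrV -addrA [_ + t *: u]addrC.
  congr (EFin (if _ then _ else _)).
  apply/idP/idP => /set_mem ct; apply/mem_set.
    by move/neg_orthant_consrV : ct => [_ /=]; rewrite in_itv.
  by apply/neg_orthant_consrV; split=> //; move: ct; rewrite /= in_itv.
rewrite -[LHS]fineK //; apply: integrable_fin_num => //.
exact: integrable_ray_line wu hf.
Qed.

End orthant.

(** * Iterated ray integrals and derivatives *)

Lemma half_supported_iter (R : realType) n (w : 'cV[R]_n) (s : seq 'rV[R]_n) f :
  (forall u, u \in s -> lform w u = 1) -> half_supported w f ->
  half_supported w (foldl (fun g u => ray_integral u g) f s).
Proof.
elim: s f => //= u s IHs f ws hf; apply: IHs => [z zs|].
  by apply: ws; rewrite inE zs orbT.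
by apply: half_supported_ray_integral => //; apply: ws; rewrite inE eqxx.
Qed.

Lemma iter_derivable_rcons (R : realType) n (s : seq 'rV[R]_n) u F :
  iter_derivable s ('D_u F) -> (forall x, derivable F x u) ->
  iter_derivable (rcons s u) F.
Proof.
move=> + dF; elim: s => [_|z s IHs [/IHs ds dz]]; first by split.
split=> [|x]; first exact: ds.
by rewrite /iter_derive foldr_rcons; exact: dz.
Qed.

(** The last vector of s is both the outermost integral and the innermost
    derivative, so the induction removes vectors from the right. *)
Lemma iter_derive_ray_integral (R : realType) n (w : 'cV[R]_n)
    (s : seq 'rV[R]_n) f :
  (forall u, u \in s -> lform w u = 1) -> half_supported w f ->
  let F := foldl (fun g u => ray_integral u g) f s in
  iter_derivable s F /\ iter_derive s F = f.
Proof.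
move=> + hf; elim/last_ind: s => [|s u IHs] //= ws.
have wu : lform w u = 1 by apply: ws; rewrite mem_rcons mem_head.
have ws' z : z \in s -> lform w z = 1.
  by move=> zs; apply: ws; rewrite mem_rcons inE zs orbT.
have [IH1 IH2] := IHs ws'.
have hF := half_supported_iter ws' hf.
rewrite foldl_rcons; set G := foldl _ f s in IH1 IH2 hF *.
have DG : 'D_u (ray_integral u G) = G.
  by apply/funext => x; case: (derive_ray_integral x wu hF).
split; last by rewrite /iter_derive foldr_rcons DG.
apply: iter_derivable_rcons; first by rewrite DG.
by move=> x; case: (derive_ray_integral x wu hF).
Qed.

(** * The inversion formula *)

Theorem theorem4 (R : realType) (n : nat) (v : n.-tuple 'rV[R]_n)
    (f : 'rV[R]_n -> R)
    (v_unit : forall i, l2norm (tnth v i) = 1)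
    (v_basis : basis_of fullv v)
    (f_Cc : Cc f) :
  let F : 'rV[R]_n -> R :=
    fun x => \int[lebesgue_rV R n]_(y in [set y | cone_le v y x]) f y in
  iter_derivable v F /\
  forall x : 'rV[R]_n,
    f x = `|\det (\matrix_(i < n, j < n) tnth v j ord0 i)|^-1
          * iter_derive v F x.
Proof.
move=> F; pose V : 'M[R]_n := \matrix_(i < n) tnth v i.
have lincombE c : lincomb v c = c *m V.
  by rewrite mulmx_sum_row; apply: eq_bigr => i _; rewrite rowK.
have uV : V \in unitmx.
  rewrite -row_free_unit; apply: inj_row_free => c cV0.
  have /freeP fv := basis_free v_basis.
  apply/rowP => i; rewrite mxE; apply: (fv (fun i => c ord0 i)).
  by rewrite -[RHS]cV0 -lincombE; apply: eq_bigr => j _; rewrite -tnth_nth.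
have detE : \det (\matrix_(i < n, j < n) tnth v j ord0 i) = \det V.
  by rewrite -det_tr; congr (\det _); apply/matrixP => i j; rewrite !mxE.
(* The linear form with value 1 on every v_i: the sum of the coordinates in the
   basis v. *)
pose w : 'cV[R]_n := invmx V *m const_mx 1.
have wv i : lform w (tnth v i) = 1.
  rewrite /lform mulmxA -[tnth v i](rowK (tnth v)) -row_mul mulmxV // row1.
  by rewrite -rowE !mxE.
have hf : half_supported w f.
  case: f_Cc => cf /(@continuous_compact _ _ (lform w)) cpt; split=> //.
  have /compact_bounded[M [_ mrt]] :
      compact (lform w @` closure [set x | f x != 0]).
    by apply: cpt; apply: continuous_subspaceT; exact: lform_continuous.
  exists (- (M + 1)) => x xM; apply/eqP; apply: contraTT xM => fx.
  have : `|lform w x| <= M + 1.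
    apply: (mrt (M + 1)); first by rewrite ltrDl.
    by exists x => //; exact: subset_closure.
  by rewrite -leNgt ler_norml => /andP[].
(* The factor |det V| is put into the function, whose class is stable under it,
   so that the iterated derivatives need not be shown linear. *)
pose k := `|\det V|.
have hkf : half_supported w (fun x => k * f x).
  case: hf => cf [M f0]; split; last by exists M => x /f0 ->; rewrite mulr0.
  by move=> x; have := cf x; exact: (@cvgMl_tmp _ _ (nbhs x) _ f k _).
have FE : F = foldl (fun g u => ray_integral u g) (fun x => k * f x) v.
  apply/funext => x; rewrite /F /Rintegral integral_mkcond.
  set g := (_ \_ _).
  have coneE c : cone_le v (x + c *m V) x <-> neg_orthant c.
    rewrite /cone_le opprD addNKr -mulNmx; split=> [[d [d0 dE]] i|c0].
      have /(can_inj (mulmxK uV)) cd : - c *m V = (\row_i d i) *m V.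
        by rewrite dE -lincombE; apply: eq_bigr => j _; rewrite mxE.
      by rewrite -[c]opprK cd !mxE oppr_le0.
    exists (fun i => - c ord0 i); split; first by move=> i; rewrite oppr_ge0.
    by rewrite -lincombE; apply: eq_bigr => i _; rewrite mxE.
  have gE c : g (x + c *m V) =
      ((EFin \o (fun c => f (x + lincomb v c))) \_ (@neg_orthant R n)) c.
    rewrite /g !patchE /= lincombE; congr (if _ then _ else _).
    by apply/idP/idP => /set_mem cn; apply/mem_set; exact/coneE.
  have cone_preim : [set y | cone_le v y x] =
      (fun y => y *m invmx V + - (x *m invmx V)) @^-1` (@neg_orthant R n).
    have yE y : y = x + (y *m invmx V + - (x *m invmx V)) *m V.
      by rewrite -mulmxBl mulmxKV // addrC subrK.
    apply/seteqP.
    by split=> y /=; [rewrite {1}(yE y)|rewrite {2}(yE y)] => /coneE.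
  have mg : measurable_fun setT g.
    apply: (iffLR (measurable_restrictT _ _)) => //.
      rewrite cone_preim -[X in measurable X]setTI.
      apply: measurable_affine_rV => //; exact: measurable_neg_orthant.
    apply/measurable_EFinP; apply: measurable_funTS.
    by apply: continuous_measurable_rV; case: hf.
  have ig : (lebesgue_rV R n).-integrable setT (fun c => g (x + c *m V)).
    under eq_fun do rewrite gE.
    apply: (iffLR (@integrable_mkcond _ _ R (lebesgue_rV R n) _ _ _)).
      exact: measurable_neg_orthant.
    exact: integrable_orthant wv hf.
  rewrite (integral_affine_rV uV mg ig); under eq_integral do rewrite gE.
  rewrite -integral_mkcond -/k -integralZl //; last 2 first.
  - exact: measurable_neg_orthant.
  - exact: integrable_orthant wv hf.
  rewrite -[RHS]/(fine _%:E) -(integral_orthant x wv hkf).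
  by congr fine; apply: eq_integral => c _; rewrite /= EFinM.
have [|dF DF] := @iter_derive_ray_integral R n w v _ _ hkf.
  by move=> u /tnthP[i ->].
rewrite FE; split=> // x; rewrite DF detE mulKf // normr_eq0.
by rewrite unitmxE unitfE in uV.
Qed.
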